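(* Let $\theta_0\in\,]0,\pi/2[$, $\ell>0$, $\kappa>0$, and let $I:[0,\infty)\to[0,1]$ be any non-decreasing function. Then the optimization problem (OP1) with light intensity $I$ has at least one optimal solution $(h,\theta)$.
   Context: Model 1 (stem of fixed length $\ell$ and constant leaf density $\kappa$; light comes from a direction making angle $\theta_0$ as below). For $\theta\in[\theta_0,\pi/2]$ define $$G(\theta)=\Big(1-\exp\Big\{\frac{-\kappa}{\cos(\theta-\theta_0)}\Big\}\Big)\cos(\theta-\theta_0),\qquad g(\theta)=\frac{G(\theta)}{\sin\theta}.$$ Given a non-decreasing light intensity function $I:[0,\infty)\to[0,1]$, problem (OP1) is: among all pairs $(h,\theta)$ with $h>0$ and $\theta:[0,h]\to[\theta_0,\pi/2]$ measurable satisfying the length constraint $\int_0^h \frac{dy}{\sin\theta(y)}=\ell$, maximize $J(h,\theta)=\int_0^h I(y)\,g(\theta(y))\,dy$. An optimal solution is an admissible pair attaining the supremum of $J$ over all admissible pairs. *)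

(* Defs.v *)
From HB Require Import structures.
From mathcomp Require Import all_boot all_order all_algebra.
From mathcomp Require Import all_classical all_reals all_analysis.
Set Implicit Arguments. Unset Strict Implicit. Unset Printing Implicit Defensive.
Import Order.TTheory GRing.Theory Num.Theory.
Import numFieldNormedType.Exports.
Local Open Scope classical_set_scope.
Local Open Scope ring_scope.

Section Model1.
Variable R : realType.

Definition Gfun (kappa theta0 theta : R) : R :=
  (1 - expR (- kappa / cos (theta - theta0))) * cos (theta - theta0).

Definition gfun (kappa theta0 theta : R) : R :=
  Gfun kappa theta0 theta / sin theta.

Definition admissible (theta0 ell : R) (h : R) (theta : R -> R) : Prop :=
  0 < h /\
  measurable_fun `[0, h] theta /\
  (forall y, 0 <= y <= h -> theta0 <= theta y <= pi / 2) /\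
  (\int[lebesgue_measure]_(y in `[0%R, h]%classic) ((sin (theta y))^-1)%:E = ell%:E)%E.

Definition Jobj (kappa theta0 : R) (I : R -> R) (h : R) (theta : R -> R)
  : \bar R :=
  (\int[lebesgue_measure]_(y in `[0%R, h]%classic) (I y * gfun kappa theta0 (theta y))%:E)%E.

Definition optimal (kappa theta0 ell : R) (I : R -> R) (h : R) (theta : R -> R)
  : Prop :=
  admissible theta0 ell h theta /\
  forall h' theta', admissible theta0 ell h' theta' ->
    (Jobj kappa theta0 I h' theta' <= Jobj kappa theta0 I h theta)%E.

End Model1.

(* Main.v *)
(** Fix the height [h] and relax the length constraint with a multiplier [lam]:
    for each [y] maximise [I y * g t - lam / sin t] over [t] in [theta0, pi/2].
    Integrating the maxima gives a dual value bounding the objective of every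
    admissible [theta].  Conversely, since [g] and [1 / sin] are monotone, the
    smallest and the largest maximiser are monotone in [y], hence measurable; at
    a critical [lam] the first is too long and the second too short, and by the
    intermediate value theorem switching from one to the other at a suitable
    height meets the constraint, so the dual value is attained.  No concavity is
    needed.  The dual value is continuous in [h], and admissible heights lie in a
    compact interval, so a cluster point of the heights of a maximising sequence
    has all its dual values above the supremum, and strong duality there gives an
    optimal solution.  At the greatest height [h = ell] the only competitor is the
    constant [pi / 2], whose value is the limit of the dual values as [lam]
    tends to infinity. *)
Require Import Defs.
From HB Require Import structures.
From mathcomp Require Import all_boot all_order all_algebra.
From mathcomp Require Import all_classical all_reals all_analysis.
From mathcomp Require Import measurable_realfun ring lra.
Set Implicit Arguments. Unset Strict Implicit. Unset Printing Implicit Defensive.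
Import Order.TTheory GRing.Theory Num.Theory.
Import numFieldNormedType.Exports.
Local Open Scope classical_set_scope.
Local Open Scope ring_scope.

(** * Integrals of bounded functions over segments *)

Section BoundedIntegrals.
Variable R : realType.
Local Notation mu := (@lebesgue_measure R).
Implicit Types (x y h B : R) (f : R -> R).

Lemma itv_measure_fin x y : (mu `[x, y]%classic < +oo)%E.
Proof. by rewrite lebesgue_measure_itv; case: ifP => // _; rewrite -EFinB ltry. Qed.

Lemma integrable_itv_bounded x y f B :
  measurable_fun `[x, y] f -> (forall t, x <= t <= y -> `|f t| <= B) ->
  mu.-integrable `[x, y] (EFin \o f).
Proof.
move=> mf fB; apply: measurable_bounded_integrable => //.
  exact: itv_measure_fin.
exists B; split; first exact: num_real.
by move=> M BM t /=; rewrite in_itv/= => /fB /le_trans; apply; exact: ltW.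
Qed.

Lemma Rintegral_itv_cst x y (c : R) :
  x <= y -> (\int[mu]_(_ in `[x, y]) c)%R = c * (y - x).
Proof.
move=> xy; rewrite Rintegral_cst//; congr (_ * _).
rewrite /= lebesgue_measure_itv/= lte_fin.
by case: ltgtP xy => //= ->; rewrite subrr.
Qed.

Lemma Rintegral_itv_bound x y f B : x <= y ->
  measurable_fun `[x, y] f -> (forall t, x <= t <= y -> `|f t| <= B) ->
  `|\int[mu]_(t in `[x, y]) f t|%R <= B * (y - x).
Proof.
move=> xy mf fB; have intf := integrable_itv_bounded mf fB.
rewrite (le_trans (le_normr_Rintegral _ intf))// -Rintegral_itv_cst//.
apply: le_Rintegral => //.
  exact: integrable_norm.
by apply: (@integrable_itv_bounded _ _ _ `|B|).
Qed.

(** The integrals cancel on the common part, and the remaining piece has length the distance of the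
    endpoints. This is the source of the continuity of the dual value in the height. *)
Lemma Rintegral_itv_lipschitz f B x y : 0 <= x -> 0 <= y ->
  (forall z : R, measurable_fun `[0, z] f) -> (forall t, `|f t| <= B) ->
  `|(\int[mu]_(t in `[0%R, x]) f t) - \int[mu]_(t in `[0%R, y]) f t|%R
     <= B * `|x - y|.
Proof.
move=> x0 y0 mf fB; wlog xy : x y x0 y0 / y <= x.
  move=> H; case: (leP y x) => xy; first exact: H.
  by rewrite distrC (distrC x); apply: H => //; exact: ltW.
rewrite Rintegral_itvB ?bnd_simp//; last first.
  by apply: (@integrable_itv_bounded _ _ _ B).
have mf' : measurable_fun `[y, x] f.
  apply: measurable_funS (mf x) => //=.
  by move=> t/=; rewrite !in_itv/= => /andP[/(le_trans y0)-> ->].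
(* The difference is an integral over a segment open at [y]; adding that null endpoint allows the
   previous bound to be used. *)
rewrite Rintegral_itv_obnd_cbnd; last first.
  apply: integrableS (integrable_itv_bounded mf' (fun t _ => fB t)) => //.
  by move=> t/=; rewrite !in_itv/= => /andP[/ltW-> ->].
rewrite [in leRHS]ger0_norm ?subr_ge0//.
by apply: Rintegral_itv_bound.
Qed.

Lemma cvg_Rintegral_itv_bounded (f_ : nat -> R -> R) f x y B :
  (forall n, measurable_fun `[x, y] (f_ n)) -> measurable_fun `[x, y] f ->
  (forall n t, x <= t <= y -> `|f_ n t| <= B) ->
  (forall t, x <= t <= y -> `|f t| <= B) ->
  (forall t, x <= t <= y -> f_ n t @[n --> \oo] --> f t) ->
  (\int[mu]_(t in `[x, y]) f_ n t)%R @[n --> \oo] --> (\int[mu]_(t in `[x, y]) f t)%R.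
Proof.
move=> mf_ mf fB fB' f_f.
have iB : mu.-integrable `[x, y] (EFin \o cst B).
  by apply: (@integrable_itv_bounded _ _ _ `|B|).
have mfE n : measurable_fun `[x, y] (EFin \o f_ n) by exact/measurable_EFinP.
have mfE' : measurable_fun `[x, y] (EFin \o f) by exact/measurable_EFinP.
have f_fE t : `[x, y]%classic t ->
    (EFin \o f_ n) t @[n --> \oo] --> (EFin \o f) t.
  rewrite /= in_itv/= => txy.
  by apply: cvg_EFin; [exact: nearW|exact: f_f].
have f_BE n t : `[x, y]%classic t ->
    (`|(EFin \o f_ n) t| <= (EFin \o cst B) t)%E.
  by rewrite /= in_itv/= => txy; rewrite lee_fin fB.
have cv := @dominated_cvg _ _ _ mu `[x, y] (measurable_itv _) _ _ (EFin \o cst B)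
  mfE f_fE (fun _ _ => isT) iB f_BE.
apply: fine_cvg; rewrite fineK//.
apply: integrable_fin_num => //.
exact: integrable_itv_bounded fB'.
Qed.

End BoundedIntegrals.

(** * Lagrangian duality *)

(** The maximisers form a superlevel set at the maximum, hence a nonempty compact set, on which the
    identity attains its minimum and its maximum. *)
Lemma extremal_argmax (R : realType) (a b : R) (f : R -> R) :
  a <= b -> continuous f ->
  let argmax t := a <= t <= b /\ forall u, a <= u <= b -> f u <= f t in
  exists mM : R * R, [/\ argmax mM.1, argmax mM.2 &
    forall t, argmax t -> mM.1 <= t <= mM.2].
Proof.
move=> ab cf argmax.
have [c cab fc] : exists2 c, c \in `[a, b] & forall t, t \in `[a, b] -> f t <= f c.
  by apply: EVT_max => //; exact: continuous_subspaceT.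
pose E : set R := `[a, b] `&` f @^-1` [set y | f c <= y].
have EP t : E t <-> argmax t.
  rewrite /E /argmax /= in_itv/=; split => [[tab ct]|[tab ft]]; split => //.
    by move=> u uab; rewrite (le_trans _ ct)// fc// in_itv.
  by apply: ft; rewrite in_itv in cab.
have cE : compact E.
  apply: subclosed_compact (@segment_compact _ a b) _; last by move=> ? [].
  apply: closedI; first exact: interval_closed.
  by apply: preimage_closed => [t _|]; [exact: cf|exact: closed_ge].
have E0 : E !=set0 by exists c; split => //=.
have idE : {within E, continuous (id : R -> R)}.
  by apply: continuous_subspaceT => t; exact: cvg_id.
have [m mE mmin] := compact_EVT_min E0 cE idE.
have [M ME Mmax] := compact_EVT_max E0 cE idE.
exists (m, M); split => /=.
- by apply/EP; rewrite -inE.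
- by apply/EP; rewrite -inE.
- by move=> t /EP/mem_set tE; rewrite mmin//= Mmax.
Qed.

(** Compactness of the segment gives a cluster point. It is described by arbitrarily late indices
    close to it, so that no subsequence has to be extracted. *)
Lemma cluster_dist (R : realType) (u_ : nat -> R) (x y : R) : (forall n, x <= u_ n <= y) ->
  exists2 z, x <= z <= y & forall (e : R) N, 0 < e ->
    exists2 n, (N <= n)%N & `|u_ n - z| < e.
Proof.
move=> uxy.
have Fxy : (u_ @ \oo) `[x, y]%classic by exists 0%N => // n _; rewrite /= in_itv/=.
have [z [/= zxy zcl]] := @segment_compact _ x y (u_ @ \oo) (fmap_proper_filter _ _) Fxy.
exists z; first by rewrite in_itv in zxy.
move=> e N e0.
(* Each tail of the sequence belongs to the filter, so the cluster point has elements of that tail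
   in every ball around it. *)
have FN : (u_ @ \oo) (u_ @` [set n | (N <= n)%N]) by exists N => // n /= Nn; exists n.
have [_ [[n Nn <-] /= zn]] := zcl _ _ FN (nbhsx_ballx z e e0).
by exists n => //; rewrite distrC.
Qed.

(* [s] and [g] stand for [1 / sin] and [gfun], extended by constants outside
   [[a, b]] so as to be continuous and monotone on the whole line. *)
Section Duality.
Variables (R : realType) (a b ell : R) (s g I : R -> R).
Local Notation mu := (@lebesgue_measure R).
Hypotheses (ab : a < b) (s_cont : continuous s) (g_cont : continuous g).
Hypotheses (s_noninc : nonincreasing_fun s) (g_noninc : nonincreasing_fun g).
Hypothesis s_decr : forall x y, a <= x -> x < y -> y <= b -> s y < s x.
Hypotheses (sb0 : 0 < s b) (gb0 : 0 <= g b) (ell0 : 0 < ell).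
Hypotheses (I_nondec : nondecreasing_fun I) (I01 : forall y, 0 <= I y <= 1).
Implicit Types (c lam h t u : R) (th : R -> R).

(** * Pointwise maximisers and their dependence on [c] and [lam] *)

Definition lagr c lam t := c * g t - lam * s t.

Definition argmax c lam t :=
  a <= t <= b /\ forall u, a <= u <= b -> lagr c lam u <= lagr c lam t.

Lemma argmax_ex c lam : exists mM : R * R, [/\ argmax c lam mM.1, argmax c lam mM.2 &
  forall t, argmax c lam t -> mM.1 <= t <= mM.2].
Proof.
apply: extremal_argmax; first exact: ltW.
move=> t; apply: cvgB; (apply: cvgM; first exact: cvg_cst).
  exact: g_cont.
exact: s_cont.
Qed.

Definition lo c lam := (projT1 (cid (argmax_ex c lam))).1.
Definition hi c lam := (projT1 (cid (argmax_ex c lam))).2.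

Lemma lo_argmax c lam : argmax c lam (lo c lam).
Proof. by rewrite /lo; case: cid => /= p []. Qed.

Lemma hi_argmax c lam : argmax c lam (hi c lam).
Proof. by rewrite /hi; case: cid => /= p []. Qed.

Lemma lo_le c lam t : argmax c lam t -> lo c lam <= t.
Proof. by rewrite /lo; case: cid => /= p [_ _ H] /H/andP[]. Qed.

Lemma hi_ge c lam t : argmax c lam t -> t <= hi c lam.
Proof. by rewrite /hi; case: cid => /= p [_ _ H] /H/andP[]. Qed.

Lemma argmax_eq c lam t u : argmax c lam t -> argmax c lam u ->
  lagr c lam t = lagr c lam u.
Proof.
by move=> [tab ft] [uab fu]; apply/eqP; rewrite eq_le fu// ft.
Qed.

Lemma argmax_max c lam t u : argmax c lam t -> a <= u <= b ->
  lagr c lam t <= lagr c lam u -> argmax c lam u.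
Proof. by move=> [_ ft] uab tu; split=> // v /ft /le_trans; apply. Qed.

(* Topkis' argument: [lagr] has decreasing differences in [(c, t)]. *)
Lemma argmax_swap c c' lam t t' : c <= c' -> t <= t' ->
  argmax c lam t -> argmax c' lam t' -> argmax c lam t' /\ argmax c' lam t.
Proof.
move=> cc tt' Et Et'; have gt := g_noninc tt'.
have [[tab ft] [tab' ft']] := (Et, Et').
have H : (c' - c) * (g t - g t') >= 0 by rewrite mulr_ge0// subr_ge0.
by split; [apply: (argmax_max Et)|apply: (argmax_max Et')] => //;
   move: (ft _ tab') (ft' _ tab) H; rewrite /lagr; nra.
Qed.

(** Otherwise [argmax_swap] would make the smaller point [lo c lam] a maximiser for [c'], below the
    least one. *)
Lemma lo_noninc lam : nonincreasing_fun (lo ^~ lam).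
Proof.
move=> c c' cc /=; rewrite leNgt; apply/negP => lt.
have [_ /lo_le] := argmax_swap cc (ltW lt) (lo_argmax c lam) (lo_argmax c' lam).
by rewrite leNgt lt.
Qed.

Lemma hi_noninc lam : nonincreasing_fun (hi ^~ lam).
Proof.
move=> c c' cc /=; rewrite leNgt; apply/negP => lt.
have [/hi_ge + _] := argmax_swap cc (ltW lt) (hi_argmax c lam) (hi_argmax c' lam).
by rewrite leNgt lt.
Qed.

(** If [t' < t], adding the two optimality inequalities contradicts the strict decrease of [s].
    Strictness in [lam] orders all maximisers, not only the extreme ones. *)
Lemma argmax_lam c lam lam' t t' : lam < lam' ->
  argmax c lam t -> argmax c lam' t' -> t <= t'.
Proof.
move=> ll [/andP[ta tb] ft] [/andP[ta' tb'] ft'].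
rewrite leNgt; apply/negP => lt.
have sst := s_decr ta' lt tb.
have := ft t'; have := ft' t; rewrite ta tb ta' tb' /lagr => /(_ isT) h1 /(_ isT) h2.
have : 0 < (lam' - lam) * (s t' - s t) by rewrite mulr_gt0 ?subr_gt0.
nra.
Qed.

(** Closed graph of the maximiser correspondence: for each competitor [u], the optimality inequality
    passes to the limit. *)
Lemma argmax_cvg c (lam_ t_ : nat -> R) lam t :
  (forall n, argmax c (lam_ n) (t_ n)) ->
  lam_ @ \oo --> lam -> t_ @ \oo --> t -> argmax c lam t.
Proof.
move=> Et lcv tcv; split.
  apply/andP; split.
    apply: (closed_cvg _ (@closed_ge _ a)) tcv; apply: nearW => n.
    by case: (Et n) => /andP[].
  apply: (closed_cvg _ (@closed_le _ b)) tcv; apply: nearW => n.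
  by case: (Et n) => /andP[].
move=> u uab; rewrite -subr_ge0.
have cv : lagr c (lam_ n) (t_ n) - lagr c (lam_ n) u @[n --> \oo] -->
    lagr c lam t - lagr c lam u.
  have gcv : g (t_ n) @[n --> \oo] --> g t by apply: cvg_comp tcv _; exact: g_cont.
  have scv : s (t_ n) @[n --> \oo] --> s t by apply: cvg_comp tcv _; exact: s_cont.
  apply: cvgB; apply: cvgB.
  - by apply: cvgM => //; exact: cvg_cst.
  - exact: cvgM.
  - exact: cvg_cst.
  - by apply: cvgM => //; exact: cvg_cst.
apply: (closed_cvg _ (@closed_ge _ 0)) cv; apply: nearW => n /=.
by rewrite subr_ge0; apply: (Et n).2.
Qed.

(** The values increase to a limit that is at most [lo c lam]; by the closed graph it is also a
    maximiser, hence at least the least one. From the right the limit could be a larger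
    maximiser. *)
Lemma lo_cvg_left c (lam_ : nat -> R) lam :
  (forall n, lam_ n < lam) -> {homo lam_ : m n / (m < n)%N >-> m < n} ->
  lam_ @ \oo --> lam -> lo c (lam_ n) @[n --> \oo] --> lo c lam.
Proof.
move=> llt lhomo lcv.
have ub n : lo c (lam_ n) <= lo c lam.
  exact: argmax_lam (llt n) (lo_argmax _ _) (lo_argmax _ _).
have cv : lo c (lam_ n) @[n --> \oo] --> sup (range (fun n => lo c (lam_ n))).
  apply: nondecreasing_cvgn.
    move=> m n; rewrite leq_eqVlt => /predU1P[->//|mn].
    exact: argmax_lam (lhomo _ _ mn) (lo_argmax _ _) (lo_argmax _ _).
  by exists (lo c lam) => _ [n _ <-].
suff -> : lo c lam = sup (range (fun n => lo c (lam_ n))) by [].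
apply/eqP; rewrite eq_le; apply/andP; split.
  apply: lo_le; apply: argmax_cvg lcv cv => n; exact: lo_argmax.
by apply: (closed_cvg _ (@closed_le _ (lo c lam))) cv; apply: nearW.
Qed.

Lemma hi_cvg_right c (lam_ : nat -> R) lam :
  (forall n, lam < lam_ n) -> {homo lam_ : m n / (m < n)%N >-> n < m} ->
  lam_ @ \oo --> lam -> hi c (lam_ n) @[n --> \oo] --> hi c lam.
Proof.
move=> llt lhomo lcv.
have lb n : hi c lam <= hi c (lam_ n).
  exact: argmax_lam (llt n) (hi_argmax _ _) (hi_argmax _ _).
have cv : hi c (lam_ n) @[n --> \oo] --> inf (range (fun n => hi c (lam_ n))).
  apply: nonincreasing_cvgn.
    move=> m n; rewrite leq_eqVlt => /predU1P[->//|mn].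
    exact: argmax_lam (lhomo _ _ mn) (hi_argmax _ _) (hi_argmax _ _).
  by exists (hi c lam) => _ [n _ <-].
suff -> : hi c lam = inf (range (fun n => hi c (lam_ n))) by [].
apply/eqP; rewrite eq_le; apply/andP; split.
  by apply: (closed_cvg _ (@closed_ge _ (hi c lam))) cv; apply: nearW.
apply: hi_ge; apply: argmax_cvg lcv cv => n; exact: hi_argmax.
Qed.


(** * Length, objective and dual value *)

Definition control h th :=
  measurable_fun `[0, h] th /\ forall y, 0 <= y <= h -> a <= th y <= b.

Definition len h th : R := (\int[mu]_(y in `[0%R, h]) s (th y))%R.
Definition obj h th : R := (\int[mu]_(y in `[0%R, h]) (I y * g (th y)))%R.
(** By [argmax_eq] every choice of maximiser gives the same integrand; [lo] has the merit of being
    monotone in [y], hence measurable. *)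
Definition dual lam h : R :=
  (\int[mu]_(y in `[0%R, h]) lagr (I y) lam (lo (I y) lam))%R + lam * ell.

Lemma s_bound t : a <= t <= b -> `|s t| <= s a.
Proof.
by move=> /andP[ta tb]; rewrite ger0_norm ?s_noninc// (le_trans (ltW sb0))// s_noninc.
Qed.

Lemma Ig_bound y t : a <= t <= b -> `|I y * g t| <= g a.
Proof.
move=> /andP[ta tb]; have /andP[I0 I1] := I01 y.
have gt0 : 0 <= g t by rewrite (le_trans gb0)// g_noninc.
by rewrite ger0_norm ?mulr_ge0// (le_trans _ (g_noninc ta))// ler_piMl.
Qed.

Lemma s_measurable h th : measurable_fun `[0, h] th ->
  measurable_fun `[0, h] (fun y => s (th y)).
Proof. by apply: measurableT_comp; exact: nonincreasing_measurable. Qed.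

Lemma Ig_measurable h th : measurable_fun `[0, h] th ->
  measurable_fun `[0, h] (fun y => I y * g (th y)).
Proof.
move=> mth; apply: measurable_funM; first exact: nondecreasing_measurable.
by move: mth; apply: measurableT_comp; exact: nonincreasing_measurable.
Qed.

Lemma s_integrable h th : control h th ->
  mu.-integrable `[0, h] (EFin \o (fun y => s (th y))).
Proof.
move=> [mth thab]; apply: integrable_itv_bounded; first exact: s_measurable.
by move=> y /thab/s_bound; apply.
Qed.

Lemma scaled_s_integrable lam h th : control h th ->
  mu.-integrable `[0, h] (EFin \o (fun y => lam * s (th y))).
Proof.
move=> [mth thab]; apply: (@integrable_itv_bounded _ _ _ _ (`|lam| * s a)).
  by apply: measurable_funM => //; exact: s_measurable.
by move=> y /thab/s_bound sB; rewrite normrM ler_wpM2l.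
Qed.

Lemma Ig_integrable h th : control h th ->
  mu.-integrable `[0, h] (EFin \o (fun y => I y * g (th y))).
Proof.
move=> [mth thab]; apply: integrable_itv_bounded; first exact: Ig_measurable.
by move=> y /thab; exact: Ig_bound.
Qed.

Lemma lagr_integrable lam h th : control h th ->
  mu.-integrable `[0, h] (EFin \o (fun y => lagr (I y) lam (th y))).
Proof.
move=> cth; rewrite (_ : _ \o _ = (fun y => (I y * g (th y))%:E - (lam * s (th y))%:E)%E)//.
apply: integrableB => //; first exact: Ig_integrable.
exact: scaled_s_integrable.
Qed.

Lemma Rintegral_lagr lam h th : control h th ->
  (\int[mu]_(y in `[0%R, h]) lagr (I y) lam (th y))%R = obj h th - lam * len h th.
Proof.
move=> cth; rewrite RintegralB//; last 2 first.
- exact: Ig_integrable.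
- exact: scaled_s_integrable.
- by rewrite RintegralZl//; exact: s_integrable.
Qed.

Lemma lo_control lam h : control h (fun y => lo (I y) lam).
Proof.
split; last by move=> y _; exact: (lo_argmax _ _).1.
by apply: nonincreasing_measurable => // x y xy; apply/lo_noninc/I_nondec.
Qed.

Lemma hi_control lam h : control h (fun y => hi (I y) lam).
Proof.
split; last by move=> y _; exact: (hi_argmax _ _).1.
by apply: nonincreasing_measurable => // x y xy; apply/hi_noninc/I_nondec.
Qed.

Lemma weak_duality lam h th : control h th -> len h th = ell ->
  obj h th <= dual lam h.
Proof.
move=> cth lth; rewrite /dual -lerBlDr -lth -Rintegral_lagr//.
apply: le_Rintegral => //.
- exact: lagr_integrable.
- by apply: lagr_integrable; exact: lo_control.
- move=> y /=; rewrite in_itv/= => yh; apply: (lo_argmax _ _).2.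
  exact: cth.2.
Qed.

(** Complement to weak duality: the pointwise inequality behind it is an equality when [th] takes
    maximisers as values. *)
Lemma dual_attained lam h th : control h th -> len h th = ell ->
  (forall y, 0 <= y <= h -> argmax (I y) lam (th y)) -> obj h th = dual lam h.
Proof.
move=> cth lth Eth; rewrite /dual (_ : (\int[mu]_(y in _) _)%R = obj h th - lam * ell).
  by rewrite subrK.
rewrite -lth -Rintegral_lagr//; apply: eq_Rintegral => y; rewrite inE/= in_itv/= => yh.
apply: argmax_eq; [exact: lo_argmax|exact: Eth].
Qed.

(** The selection [lo (I y) lam] does not depend on the height, so changing [h] only adds or removes
    a piece of the integral of a bounded function. *)
Lemma dual_lipschitz lam h h' : 0 <= h -> 0 <= h' ->
  `|dual lam h - dual lam h'| <= (g a + `|lam| * s a) * `|h - h'|.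
Proof.
move=> h0 h'0; rewrite /dual opprD addrACA subrr addr0.
apply: Rintegral_itv_lipschitz => //.
  by move=> z; have /integrableP[/measurable_EFinP] := lagr_integrable lam (lo_control lam z).
move=> y; have yab := (lo_argmax (I y) lam).1.
by rewrite (le_trans (ler_normB _ _))// lerD ?Ig_bound// normrM ler_wpM2l// s_bound.
Qed.

Lemma len_bounds h th : 0 <= h -> control h th -> s b * h <= len h th <= s a * h.
Proof.
move=> h0 cth; rewrite -{1 4}(subr0 h) -!Rintegral_itv_cst//.
have cst_int (c : R) : mu.-integrable `[0, h] (EFin \o (fun=> c)).
  by apply: (@integrable_itv_bounded _ _ _ _ `|c|).
apply/andP; split; (apply: le_Rintegral => //; try exact: s_integrable);
  by move=> y /=; rewrite in_itv/= => /cth.2/andP[ya yb]; exact: s_noninc.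
Qed.


(** * Critical multiplier and strong duality *)

Lemma le_len h th th' : control h th -> control h th' ->
  (forall y, 0 <= y <= h -> th' y <= th y) -> len h th <= len h th'.
Proof.
move=> cth cth' thth'; apply: le_Rintegral => //; try exact: s_integrable.
by move=> y /=; rewrite in_itv/= => /thth'; exact: s_noninc.
Qed.

Lemma lo_lam0 c : 0 <= c -> lo c 0 = a.
Proof.
move=> c0; apply/eqP; rewrite eq_le (andP (lo_argmax c 0).1).1 andbT.
apply: lo_le; split; first by rewrite lexx ltW.
by move=> u /andP[ua _]; rewrite /lagr !mul0r !subr0 ler_wpM2l// g_noninc.
Qed.

(** Comparison of the maximiser with the competitor [b]: the penalty [lam * (s (lo c lam) - s b)]
    cannot exceed the gain in [g], which is at most [g a]. A large multiplier thus makes the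
    selection nearly as short as possible. *)
Lemma s_lo_le c lam : 0 <= c <= 1 -> 0 < lam -> s (lo c lam) <= s b + g a / lam.
Proof.
move=> /andP[c0 c1] lam0; have [/andP[ta tb] /(_ b)] := lo_argmax c lam.
rewrite lexx ltW//= /lagr => /(_ isT) h1.
rewrite -lerBlDl ler_pdivlMr//.
have : c * g (lo c lam) <= g a.
  have gt0 : 0 <= g (lo c lam) by rewrite (le_trans gb0)// g_noninc.
  by rewrite (le_trans _ (g_noninc ta))// ler_piMl.
have : 0 <= c * g b by rewrite mulr_ge0.
nra.
Qed.

Lemma len_lo_cvg h lam :
  len h (fun y => lo (I y) (lam - harmonic n)) @[n --> \oo] -->
  len h (fun y => lo (I y) lam).
Proof.
apply: (@cvg_Rintegral_itv_bounded _ _ _ _ _ (s a)).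
- by move=> n; apply: s_measurable; exact: (lo_control _ h).1.
- by apply: s_measurable; exact: (lo_control _ h).1.
- by move=> n y _; apply: s_bound; exact: (lo_argmax _ _).1.
- by move=> y _; apply: s_bound; exact: (lo_argmax _ _).1.
- move=> y _; apply: cvg_comp; last exact: s_cont.
  apply: lo_cvg_left.
  + by move=> n; rewrite ltrBlDr ltrDl harmonic_gt0.
  + by move=> m n mn; rewrite ltrD2l ltrN2 ltf_pV2 ?posrE// ltr_nat.
  + rewrite -[X in _ --> X]subr0; apply: cvgB; first exact: cvg_cst.
    exact: cvg_harmonic.
Qed.

Lemma len_hi_cvg h lam :
  len h (fun y => hi (I y) (lam + harmonic n)) @[n --> \oo] -->
  len h (fun y => hi (I y) lam).
Proof.
apply: (@cvg_Rintegral_itv_bounded _ _ _ _ _ (s a)).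
- by move=> n; apply: s_measurable; exact: (hi_control _ h).1.
- by apply: s_measurable; exact: (hi_control _ h).1.
- by move=> n y _; apply: s_bound; exact: (hi_argmax _ _).1.
- by move=> y _; apply: s_bound; exact: (hi_argmax _ _).1.
- move=> y _; apply: cvg_comp; last exact: s_cont.
  apply: hi_cvg_right.
  + by move=> n; rewrite ltrDl harmonic_gt0.
  + by move=> m n mn; rewrite ltrD2l ltf_pV2 ?posrE// ltr_nat.
  + rewrite -[X in _ --> X]addr0; apply: cvgD; first exact: cvg_cst.
    exact: cvg_harmonic.
Qed.

(* Take the last multiplier for which the selection [lo] is still long enough. *)
Lemma critical_multiplier h : 0 < h -> s b * h < ell -> ell <= s a * h ->
  exists lam, len h (fun y => hi (I y) lam) <= ell <= len h (fun y => lo (I y) lam).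
Proof.
move=> h0 hb ha.
pose A := [set lam | ell <= len h (fun y => lo (I y) lam)].
(* With no penalty the least maximiser is [a], which gives the greatest length [s a * h]. *)
have A0 : A 0.
  rewrite /A/= /len (_ : (\int[mu]_(y in _) _)%R = s a * h)//.
  transitivity (s a * (h - 0)); last by rewrite subr0.
  rewrite -(Rintegral_itv_cst _ (ltW h0)).
  by apply: eq_Rintegral => y _; rewrite lo_lam0// (andP (I01 y)).1.
have Adown lam lam' : lam < lam' -> A lam' -> A lam.
  move=> ll /le_trans; apply; apply: le_len; try exact: lo_control.
  by move=> y _; exact: argmax_lam ll (lo_argmax _ _) (lo_argmax _ _).
(* Beyond this bound, [h * (s b + g a / lam)], which dominates the length by [s_lo_le], is less than
   [ell]. *)
have Aub : ubound A (h * g a / (ell - s b * h)).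
  move=> lam; rewrite /A/= => Alam; rewrite leNgt; apply/negP => lt.
  have D0 : 0 < ell - s b * h by rewrite subr_gt0.
  have ga0 : 0 <= g a by rewrite (le_trans gb0)// g_noninc// ltW.
  have lam0 : 0 < lam.
    by apply: le_lt_trans lt; apply: divr_ge0; rewrite ?mulr_ge0// ltW.
  have : len h (fun y => lo (I y) lam) <= (s b + g a / lam) * (h - 0).
    rewrite -(Rintegral_itv_cst _ (ltW h0)); apply: le_Rintegral => //.
    - by apply: s_integrable; exact: lo_control.
    - by apply: (@integrable_itv_bounded _ _ _ _ `|s b + g a / lam|).
    - by move=> y _; exact: s_lo_le.
  move=> /(le_trans Alam); rewrite subr0 mulrDl -lerBlDl leNgt => /negP; apply.
  by rewrite mulrAC ltr_pdivrMr// mulrC (mulrC _ lam) -ltr_pdivrMr.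
have Asup : has_sup A by split; [exists 0|exists (h * g a / (ell - s b * h))].
exists (sup A); apply/andP; split.
  (* Just above [sup A] even [lo] is too short, and [hi] is no longer than [lo]; right continuity of
     [hi] carries this to [sup A]. *)
  have cv := @len_hi_cvg h (sup A).
  apply: (closed_cvg _ (@closed_le _ ell)) cv; apply: nearW => n.
  apply: (@le_trans _ _ (len h (fun y => lo (I y) (sup A + harmonic n)))).
    apply: le_len; [exact: hi_control|exact: lo_control|].
    by move=> y _; apply: lo_le; exact: hi_argmax.
  rewrite leNgt; apply/negP => /ltW An.
  have := sup_upper_bound Asup An; rewrite leNgt => /negP; apply.
  by rewrite ltrDl harmonic_gt0.
(* Below [sup A] the selection [lo] is long enough, because [A] is closed downwards; left continuity
   of [lo] carries this to [sup A]. *)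
have cv := @len_lo_cvg h (sup A).
apply: (closed_cvg _ (@closed_ge _ ell)) cv; apply: nearW => n.
have [lam Alam lt] := sup_adherent (harmonic_gt0 n) Asup.
exact: Adown lt Alam.
Qed.

Lemma strong_duality h : 0 < h -> s b * h < ell -> ell <= s a * h ->
  exists lam th, [/\ control h th, len h th = ell & obj h th = dual lam h].
Proof.
move=> h0 hb ha; have [lam /andP[hi_le lo_ge]] := critical_multiplier h0 hb ha.
exists lam.
pose fhi y := s (hi (I y) lam); pose flo y := s (lo (I y) lam).
have ihi x : mu.-integrable `[0, x] (EFin \o fhi).
  by apply: s_integrable; exact: hi_control.
have ilo x : mu.-integrable `[0, x] (EFin \o flo).
  by apply: s_integrable; exact: lo_control.
(* [F x] is the length of the control that follows [hi] up to height [x] and [lo] above it, written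
   so that its continuity is that of integrals in their upper limit. *)
pose F x : R := (\int[mu]_(y in `[0%R, x]) fhi y)%R - (\int[mu]_(y in `[0%R, x]) flo y)%R
  + len h (fun y => lo (I y) lam).
have [al alh Fal] : exists2 al, al \in `[0, h] & F al = ell.
  apply: IVT; first exact: ltW.
    move=> x; rewrite /F; apply: cvgD; last exact: cvg_cst.
    apply: cvgB.
      exact: (parameterized_integral_continuous (ltW h0) (ihi h)).
    exact: (parameterized_integral_continuous (ltW h0) (ilo h)).
  have -> : F 0 = len h (fun y => lo (I y) lam).
    by rewrite /F set_itv1 !Rintegral_set1 subrr add0r.
  have -> : F h = len h (fun y => hi (I y) lam) by rewrite /F subrK.
  by rewrite ge_min hi_le orbT le_max lo_ge.
rewrite in_itv/= in alh; have [al0 alh'] := andP alh.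
pose th y := if y <= al then hi (I y) lam else lo (I y) lam.
have Eth y : argmax (I y) lam (th y).
  by rewrite /th; case: ifP => _; [exact: hi_argmax|exact: lo_argmax].
have cth : control h th.
  split; last by move=> y _; exact: (Eth y).1.
  apply: nonincreasing_measurable => // x y xy; rewrite /th.
  case: (leP y al) => yal.
    by rewrite (le_trans xy yal); apply/hi_noninc/I_nondec.
  case: (leP x al) => _; last by apply/lo_noninc/I_nondec.
  (* Across the switch the control still decreases, since it passes from the greatest to the least
     maximiser: this order makes [th] monotone, hence measurable. *)
  apply: (@le_trans _ _ (lo (I x) lam)); first by apply/lo_noninc/I_nondec.
  by apply: lo_le; exact: hi_argmax.
have lth : len h th = ell.
  rewrite -Fal /F /len.
  have /= B1 := @Rintegral_itvB R (fun y => s (th y)) (BLeft 0) (BRight h) al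
    (s_integrable cth) _ _.
  have /= B2 := @Rintegral_itvB R flo (BLeft 0) (BRight h) al (ilo h) _ _.
  rewrite !bnd_simp in B1 B2.
  have E1 : (\int[mu]_(y in `[0%R, al]) s (th y))%R = (\int[mu]_(y in `[0%R, al]) fhi y)%R.
    by apply: eq_Rintegral => y; rewrite inE/= in_itv/= /th => /andP[_ ->].
  have E2 : (\int[mu]_(y in `]al, h]) s (th y))%R = (\int[mu]_(y in `]al, h]) flo y)%R.
    by apply: eq_Rintegral => y; rewrite inE/= in_itv/= /th => /andP[]; case: leP.
  have := B1 al0 alh'; have := B2 al0 alh'; rewrite E1 E2 => <- /eqP.
  by rewrite subr_eq => /eqP ->; rewrite /flo addrC -addrA; congr (_ + _); rewrite addrC.
by exists th; split => //; apply: dual_attained.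
Qed.


(** * The greatest height *)

Lemma cst_control h : control h (fun=> b).
Proof. by split => // y _; rewrite lexx ltW. Qed.

Lemma len_cst h : 0 <= h -> len h (fun=> b) = s b * h.
Proof. by move=> h0; rewrite /len Rintegral_itv_cst// subr0. Qed.

(* At the greatest admissible height the dual value is in general only
   approached, as [lam] tends to infinity. *)
Lemma dual_endpoint h (e : R) : 0 < h -> s b * h = ell -> 0 < e ->
  exists lam, dual lam h <= obj h (fun=> b) + e.
Proof.
(* A pointwise loss of [r] integrates to [e] over the height [h]. *)
move=> h0 hb e0; have [r r0 rh] : exists2 r : R, 0 < r & r * h = e.
  by exists (e / h); rewrite ?divr_gt0// divfK// gt_eqF.
have ga0 : 0 <= g a by rewrite (le_trans gb0)// g_noninc// ltW.
have /nbhs_ballP[d /= d0 dP] : \forall t \near b, `|g b - g t| < r.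
  have gb : g t @[t --> b] --> g b by exact: g_cont.
  by move/cvgrPdist_lt : gb; apply.
(* The point [u] separates two regimes: above it [g] exceeds [g b] by less than [r]; up to it the
   penalty is at least [lam * (s u - s b)], which the choice of [lam] makes equal to [g a] and so
   greater than or equal to any gain in [g]. *)
pose u := Num.max a (b - d).
have ua : a <= u by rewrite le_max lexx.
have du : b - d <= u by rewrite le_max lexx orbT.
have ub : u < b by rewrite gt_max ab ltrBlDr ltrDl.
have eta0 : 0 < s u - s b by rewrite subr_gt0 s_decr.
exists (g a / (s u - s b)); set lam := _ / _.
have lam0 : 0 <= lam by rewrite divr_ge0// ltW.
have lam_eta : lam * (s u - s b) = g a by rewrite divfK// gt_eqF.
clearbody lam u.
have key c t : 0 <= c <= 1 -> a <= t <= b -> lagr c lam t <= lagr c lam b + r.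
  move=> /andP[c0 c1] /andP[ta tb].
  have gbt : g b <= g t by apply: g_noninc.
  have sbt : s b <= s t by apply: s_noninc.
  have gta : g t <= g a by apply: g_noninc.
  suff : (g t - g b) - lam * (s t - s b) <= r.
    have -> : lagr c lam t = lagr c lam b + (c * (g t - g b) - lam * (s t - s b)).
      by rewrite /lagr; ring.
    by rewrite lerD2l; apply: le_trans; rewrite lerD2r ler_piMl// subr_ge0.
  have [tu|ut] := leP t u.
    have : lam * (s u - s b) <= lam * (s t - s b) by rewrite ler_wpM2l// lerD2r s_noninc.
    by rewrite lam_eta; have := gta; have := gb0; have := r0; lra.
  have : `|g b - g t| < r.
    apply: dP; rewrite /ball/= ger0_norm ?subr_ge0// ltrBlDr -ltrBlDl.
    exact: le_lt_trans ut.
  have : 0 <= lam * (s t - s b) by rewrite mulr_ge0// subr_ge0.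
  by rewrite ler0_norm ?subr_le0//; move: r0; lra.
have ieh : mu.-integrable `[0, h] (EFin \o (fun=> r)).
  by apply: (@integrable_itv_bounded _ _ _ _ `|r|).
rewrite /dual -lerBrDr.
have -> : obj h (fun=> b) + e - lam * ell =
    (\int[mu]_(y in `[0%R, h]) (lagr (I y) lam b + r))%R.
  rewrite RintegralD//; last exact: (lagr_integrable lam (cst_control h)).
  rewrite (Rintegral_lagr lam (cst_control h)) len_cst ?ltW// hb.
  rewrite (Rintegral_itv_cst _ (ltW h0)) subr0 rh.
  by rewrite addrAC.
apply: le_Rintegral => //.
- by apply: lagr_integrable; exact: lo_control.
- exact: integrableD (lagr_integrable lam (cst_control h)) ieh.
- by move=> y _; apply: key => //; exact: (lo_argmax _ _).1.
Qed.

(** * Existence of an optimal pair *)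

Definition feasible h th := [/\ 0 < h, control h th & len h th = ell].

Lemma feasible_height h th : feasible h th -> ell / s a <= h <= ell / s b.
Proof.
move=> [h0 cth lth]; have sa0 : 0 < s a by rewrite (lt_le_trans sb0)// s_noninc// ltW.
have := len_bounds (ltW h0) cth; rewrite lth => /andP[l1 l2].
by rewrite ler_pdivrMr// ler_pdivlMr// mulrC l2 mulrC l1.
Qed.

Lemma optimal_exists : exists h th, feasible h th /\
  forall h' th', feasible h' th' -> obj h' th' <= obj h th.
Proof.
have sa0 : 0 < s a by rewrite (lt_le_trans sb0)// s_noninc// ltW.
have ga0 : 0 <= g a by rewrite (le_trans gb0)// g_noninc// ltW.
pose V := [set v | exists h th, feasible h th /\ v = obj h th].
have V0 : V !=set0.
  have h0 : 0 < ell / s b by rewrite divr_gt0.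
  exists (obj (ell / s b) (fun=> b)), (ell / s b), (fun=> b); split => //.
  split => //; first exact: cst_control.
  by rewrite len_cst ?ltW// mulrC divfK// gt_eqF.
have Vub : has_ubound V.
  exists (g a * (ell / s b)) => _ [h [th [fth ->]]].
  have /andP[_ hb] := feasible_height fth; have [h0 cth _] := fth.
  rewrite (le_trans (ler_norm _))//.
  apply: (@le_trans _ _ (g a * (h - 0))); last by rewrite subr0 ler_wpM2l.
  apply: Rintegral_itv_bound; [exact: ltW|exact: Ig_measurable cth.1|].
  by move=> y /cth.2; exact: Ig_bound.
have Vsup : has_sup V by split.
have [h_ h_P] : {h_ : nat -> R & forall n, exists th,
    feasible (h_ n) th /\ sup V - harmonic n < obj (h_ n) th}.
  apply: (@choice _ _ (fun n h =>
    exists th, feasible h th /\ sup V - harmonic n < obj h th)) => n.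
  have [_ [h [th [fth ->]]] lt] := sup_adherent (harmonic_gt0 n) Vsup.
  by exists h, th.
have hab n : ell / s a <= h_ n <= ell / s b.
  by have [th [/feasible_height]] := h_P n.
have [h /andP[ha hb] hcl] := cluster_dist hab.
have h0 : 0 < h by rewrite (lt_le_trans _ ha)// divr_gt0.
have hle : s b * h <= ell by rewrite mulrC -ler_pdivlMr.
have hge : ell <= s a * h by rewrite mulrC -ler_pdivrMr.
(* Suppose the dual value at [h] falls short of [sup V] by [e]. At a late height close to [h],
   near-optimality loses less than [e / 2] and the Lipschitz bound at most [e / 2], which
   contradicts weak duality there. *)
have Sdual lam : sup V <= dual lam h.
  rewrite leNgt; apply/negP => lt; pose e := sup V - dual lam h.
  have e0 : 0 < e / 2 by rewrite divr_gt0// subr_gt0.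
  pose K := g a + `|lam| * s a.
  have K0 : 0 <= K by rewrite addr_ge0// mulr_ge0// ltW.
  have /cvgrPdist_lt/(_ _ e0)[N _ NP] := @cvg_harmonic R.
  (* The Lipschitz constant [K] may vanish; [K + 1] is a safe divisor. *)
  have d0 : 0 < e / 2 / (K + 1) by rewrite divr_gt0// ltr_wpDl.
  have [n Nn dn] := hcl _ N d0.
  have := NP _ Nn; rewrite sub0r normrN ger0_norm ?harmonic_ge0// => hn.
  have [th [fth objn]] := h_P n; have [hn0 cth lth] := fth.
  have := dual_lipschitz lam (ltW hn0) (ltW h0); rewrite -/K => lip.
  have := weak_duality lam cth lth => wd.
  have : K * `|h_ n - h| <= e / 2.
    rewrite (@le_trans _ _ ((K + 1) * `|h_ n - h|))// ?ler_wpM2r// ?lerDl//.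
    by rewrite mulrC -ler_pdivlMr ?ltr_wpDl// ltW.
  have := ler_norm (dual lam (h_ n) - dual lam h).
  move: hn objn wd lip; rewrite /e; lra.
have Sopt h' th' : feasible h' th' -> obj h' th' <= sup V.
  by move=> f; apply: sup_upper_bound => //; exists h', th'.
move: hle; rewrite le_eqVlt => /predU1P[hE|hlt].
  exists h, (fun=> b); split.
    by split => //; [exact: cst_control|rewrite len_cst ?ltW].
  move=> h' th' /Sopt/le_trans; apply; apply/ler_addgt0Pr => e e0.
  have [lam] := dual_endpoint h0 hE e0.
  exact: le_trans.
have [lam [th [cth lth objE]]] := strong_duality h0 hlt hge.
exists h, th; split => //.
by move=> h' th' /Sopt/le_trans; apply; rewrite objE.
Qed.

End Duality.

(** * The functions of Model 1 *)

Section Model.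
Variables (R : realType) (theta0 kappa : R).
Hypotheses (theta0_gt0 : 0 < theta0) (theta0_lt : theta0 < pi / 2) (kappa0 : 0 < kappa).
Implicit Types t u x y : R.

(* Convexity of [expR]: tangent lines at [- kappa / y], evaluated at
   [- kappa / x] and at [0]. *)
Lemma saturation_nondec x y : 0 < x -> x <= y ->
  (1 - expR (- kappa / x)) * x <= (1 - expR (- kappa / y)) * y.
Proof.
move=> x0 xy; have y0 : 0 < y by apply: lt_le_trans xy.
set q := kappa / y; have qy : q * y = kappa by rewrite divfK// gt_eqF.
set p := kappa / x; have px : p * x = kappa by rewrite divfK// gt_eqF.
rewrite !mulNr -/p -/q; clearbody p q.
have e2 := expR_gt0 (- q).
have h1 : expR (- q) * (1 + (q - p)) <= expR (- p).
  have -> : expR (- p) = expR (- q) * expR (q - p) by rewrite -expRD; congr expR; ring.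
  by rewrite ler_pM2l// expR_ge1Dx.
have h2 : expR (- q) * (1 + q) <= 1.
  rewrite [leRHS](_ : 1 = expR (- q) * expR q); last by rewrite -expRD addNr expR0.
  by rewrite ler_pM2l// expR_ge1Dx.
rewrite -subr_ge0; set E := expR (- q) in e2 h1 h2 *; set D := expR (- p) in h1 *.
clearbody E D.
have k1 : 0 <= x * (D - E * (1 + (q - p))) by rewrite mulr_ge0 ?subr_ge0// ltW.
have k2 : 0 <= (y - x) * (1 - E * (1 + q)) by rewrite mulr_ge0 ?subr_ge0.
suff -> : (1 - E) * y - (1 - D) * x =
    x * (D - E * (1 + (q - p))) + (y - x) * (1 - E * (1 + q)).
  exact: addr_ge0.
(* The two sides differ by exactly this term, which vanishes because [q * y] and [p * x] both equal
   [kappa]. *)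
have : E * (q * y - p * x) = 0 by rewrite qy px subrr mulr0.
move=> H; rewrite -[LHS]subr0 -H; ring.
Qed.

Lemma sin_gt0_range t : theta0 <= t <= pi / 2 -> 0 < sin t.
Proof.
move=> /andP[t0 t1]; apply: sin_gt0_pi; rewrite (lt_le_trans theta0_gt0 t0)/=.
by rewrite (le_lt_trans t1)// ltr_pdivrMr// ltr_pMr ?pi_gt0// ltr1n.
Qed.

Lemma sin_lt_range t u : theta0 <= t -> t < u -> u <= pi / 2 -> sin t < sin u.
Proof.
move=> t0 tu u1; have pi0 := @pi_gt0 R.
have th0 : - (pi / 2) <= theta0 :> R by rewrite (@le_trans _ _ 0)// ?oppr_le0 ?divr_ge0 ?ltW.
by rewrite ltr_sin// in_itv/= ?(le_trans th0)// ?u1 ?(le_trans t0 (ltW tu))//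
  (le_trans (ltW tu)).
Qed.

Lemma cos_gt0_range t : theta0 <= t <= pi / 2 -> 0 < cos (t - theta0).
Proof.
move=> /andP[t0 t1]; apply: cos_gt0_pihalf; have pi0 := @pi_gt0 R.
move: t0 t1 pi0 theta0_gt0 theta0_lt; lra.
Qed.

Lemma cos_le_range t u : theta0 <= t -> t <= u -> u <= pi / 2 ->
  cos (u - theta0) <= cos (t - theta0).
Proof.
move=> t0; rewrite le_eqVlt => /predU1P[->//|tu u1]; have pi0 := @pi_gt0 R.
rewrite ltW// ltr_cos ?ltrD2r// in_itv/=; apply/andP; split;
  move: t0 tu u1 pi0 theta0_gt0 theta0_lt; lra.
Qed.

Lemma Gfun_ge0 t : theta0 <= t <= pi / 2 -> 0 <= Gfun kappa theta0 t.
Proof.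
move=> /cos_gt0_range c0; rewrite /Gfun mulr_ge0 ?(ltW c0)// subr_ge0 -[leRHS]expR0.
by rewrite ler_expR mulNr oppr_le0 divr_ge0// ltW.
Qed.

(** Composition with this projection onto the range of angles makes the model functions continuous
    and monotone on the whole line, without changing them on the range. *)
Definition clamp t := Num.max theta0 (Num.min t (pi / 2)).

Lemma clamp_range t : theta0 <= clamp t <= pi / 2.
Proof. by rewrite /clamp le_max lexx ge_max ge_min lexx orbT (ltW theta0_lt). Qed.

Lemma clamp_id t : theta0 <= t <= pi / 2 -> clamp t = t.
Proof. by move=> /andP[t0 t1]; rewrite /clamp min_l// max_r. Qed.

Lemma clamp_nondec t u : t <= u -> clamp t <= clamp u.
Proof. by move=> tu; rewrite /clamp ge_max !le_max lexx !le_min !ge_min tu lexx /= !orbT. Qed.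

Lemma clamp_continuous : continuous clamp.
Proof.
move=> t; apply: (@continuous_max R R (cst theta0) (id \min cst (pi / 2))).
  exact: cvg_cst.
by apply: (@continuous_min R R id (cst (pi / 2))); [exact: cvg_id|exact: cvg_cst].
Qed.

Lemma sinV_clamp_continuous : continuous (fun t => (sin (clamp t))^-1).
Proof.
move=> t; apply: cvgV; first by rewrite gt_eqF// sin_gt0_range// clamp_range.
by apply: cvg_comp; [exact: clamp_continuous|exact: continuous_sin].
Qed.

Lemma sinV_clamp_noninc : nonincreasing_fun (fun t => (sin (clamp t))^-1).
Proof.
move=> t u /clamp_nondec; have /andP[t0 t1] := clamp_range t.
have /andP[u0 u1] := clamp_range u.
rewrite le_eqVlt => /predU1P[->//|lt].
by rewrite lef_pV2 ?posrE ?sin_gt0_range ?clamp_range// ltW// sin_lt_range.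
Qed.

Lemma gfun_clamp_continuous : continuous (gfun kappa theta0 \o clamp).
Proof.
move=> t; have ccv : cos (clamp x - theta0) @[x --> t] --> cos (clamp t - theta0).
  apply: cvg_comp; last exact: continuous_cos.
  by apply: cvgB; [exact: clamp_continuous|exact: cvg_cst].
apply: cvgM; last exact: sinV_clamp_continuous.
apply: cvgM => //; apply: cvgB; first exact: cvg_cst.
apply: cvg_comp; last exact: continuous_expR.
apply: cvgM; first exact: cvg_cst.
by apply: cvgV => //; rewrite gt_eqF// cos_gt0_range// clamp_range.
Qed.

(** Both factors are nonnegative and nonincreasing: [Gfun] is the saturation function, nondecreasing
    in the cosine, and the cosine decreases with the angle. *)
Lemma gfun_clamp_noninc : nonincreasing_fun (gfun kappa theta0 \o clamp).
Proof.
move=> t u tu; rewrite /= /gfun ler_pM ?Gfun_ge0 ?clamp_range//.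
- by rewrite invr_ge0 ltW// sin_gt0_range// clamp_range.
- apply: saturation_nondec; first by rewrite cos_gt0_range ?clamp_range.
  by rewrite cos_le_range ?clamp_nondec// ?(andP (clamp_range _)).1
    ?(andP (clamp_range _)).2.
- exact: sinV_clamp_noninc.
Qed.

End Model.

(** * Transfer to the original problem *)

Lemma integral_itv_EFin (R : realType) (h : R) (f : R -> R) :
  lebesgue_measure.-integrable `[0, h] (EFin \o f) ->
  (\int[lebesgue_measure]_(y in `[0%R, h]) (f y)%:E =
   (\int[lebesgue_measure]_(y in `[0%R, h]) f y)%R%:E)%E.
Proof. by move=> fi; rewrite /Rintegral fineK//; exact: integrable_fin_num. Qed.

Theorem theorem3p1 (R : realType) (theta0 ell kappa : R) (I : R -> R) :
  0 < theta0 -> theta0 < pi / 2 -> 0 < ell -> 0 < kappa ->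
  (forall y, 0 <= y -> 0 <= I y <= 1) ->
  (forall x y, 0 <= x -> x <= y -> I x <= I y) ->
  exists (h : R) (theta : R -> R), optimal kappa theta0 ell I h theta.
Proof.
move=> th0 th1 ell0 kappa0 I01 I_nondec.
pose s t := (sin (clamp theta0 t))^-1.
pose g := gfun kappa theta0 \o clamp theta0.
(* The intensity is extended by [I 0] to negative heights, so that it is monotone on the whole line;
   no integral over [[0, h]] changes. *)
pose I' y := I (Num.max 0 y).
have bb : theta0 <= @pi R / 2 <= @pi R / 2 by rewrite lexx ltW.
have I'01 y : 0 <= I' y <= 1 by apply: I01; rewrite le_max lexx.
have s_decr x y : theta0 <= x -> x < y -> y <= pi / 2 -> s y < s x.
  move=> x0 xy y1.
  have xab : theta0 <= x <= pi / 2 by rewrite x0 (le_trans (ltW xy)).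
  have yab : theta0 <= y <= pi / 2 by rewrite y1 (le_trans x0 (ltW xy)).
  rewrite /s !clamp_id// ltf_pV2 ?posrE ?(sin_gt0_range th0)//.
  exact: (sin_lt_range th0 x0 xy y1).
have sb0 : 0 < s (pi / 2) by rewrite /s clamp_id// invr_gt0 (sin_gt0_range th0).
have gb0 : 0 <= g (pi / 2).
  rewrite /g /= clamp_id// /gfun divr_ge0 ?Gfun_ge0//.
  by rewrite ltW// (sin_gt0_range th0).
have I'_nondec : nondecreasing_fun I'.
  move=> x y xy; apply: I_nondec; first by rewrite le_max lexx.
  by rewrite ge_max !le_max lexx xy orbT.
have [h [th [[h0 cth lth] opt]]] := optimal_exists th1
  (sinV_clamp_continuous th0 th1) (gfun_clamp_continuous th0 th1)
  (sinV_clamp_noninc th0 th1) (gfun_clamp_noninc th0 th1 kappa0)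
  s_decr sb0 gb0 ell0 I'_nondec I'01.
have s_int h' th' : control theta0 (pi / 2) h' th' ->
    (\int[lebesgue_measure]_(y in `[0%R, h']) ((sin (th' y))^-1)%:E = (len s h' th')%:E)%E.
  move=> cth'; rewrite -integral_itv_EFin; last first.
    exact: (s_integrable (sinV_clamp_noninc th0 th1) sb0 cth').
  apply: eq_integral => y; rewrite inE/= in_itv/= => yh.
  by rewrite /s clamp_id//; exact: cth'.2.
have objE h' th' : control theta0 (pi / 2) h' th' ->
    Jobj kappa theta0 I h' th' = (obj g I' h' th')%:E.
  move=> cth'; rewrite /obj -integral_itv_EFin; last first.
    exact: (Ig_integrable (gfun_clamp_noninc th0 th1 kappa0) gb0 I'_nondec I'01 cth').
  apply: eq_integral => y; rewrite inE/= in_itv/= => yh.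
  by rewrite /g /= clamp_id ?cth'.2// /I' max_r// (andP yh).1.
exists h, th; split.
  by split=> //; split; [exact: cth.1|split; [exact: cth.2|rewrite s_int// lth]].
move=> h' th' [h'0 [mth' [th'ab lth']]].
have cth' : control theta0 (pi / 2) h' th' by [].
rewrite !objE// lee_fin; apply: opt; split => //.
by move: lth'; rewrite s_int// => -[].
Qed.
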